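(* For every real $x>0$, the set $\Lambda(x)=\{\lambda>0 : x\in E_\lambda\}$ is a Lebesgue null set which contains neither interior points nor isolated points, and moreover $\min\Lambda(x)=2x$ and $\sup\Lambda(x)=\infty$.
   Context: For $\lambda>0$, $E_\lambda$ denotes the self-similar set generated by the iterated function system $\{f_0(t)=t/3,\ f_1(t)=(t+\lambda)/3\}$ on $\mathbb{R}$, i.e. the unique nonempty compact set with $E_\lambda=f_0(E_\lambda)\cup f_1(E_\lambda)$; equivalently $E_\lambda=\left\{\sum_{i=1}^\infty d_i/3^i : d_i\in\{0,\lambda\}\right\}=\frac{\lambda}{2}C_{1/3}$, where $C_{1/3}=\left\{\sum_{i\ge1} d_i/3^i: d_i\in\{0,2\}\right\}$ is the middle-third Cantor set. *)

(* Defs.v *)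
From HB Require Import structures.
From mathcomp Require Import all_boot all_order all_algebra.
From mathcomp Require Import all_classical all_reals all_analysis.
From mathcomp Require Import ring lra.
Set Implicit Arguments. Unset Strict Implicit. Unset Printing Implicit Defensive.
Import Order.TTheory GRing.Theory Num.Theory.
Import numFieldNormedType.Exports.
Local Open Scope classical_set_scope.
Local Open Scope ring_scope.

Definition f0 (R : realType) (t : R) : R := t / 3.

Definition f1 (R : realType) (l t : R) : R := (t + l) / 3.

Definition self_similar (R : realType) (l : R) : set (set R) :=
  [set K | [/\ K !=set0, compact K & K = @f0 R @` K `|` f1 l @` K]].

(* The default value set0 is irrelevant: for 0 < l,
   E_self_similar and E_unique show that there is exactly one such set. *)
Definition E (R : realType) (l : R) : set R := xget set0 (self_similar l).

Definition Lambda (R : realType) (x : R) : set R := [set l | 0 < l /\ E l x].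

Section well_defined.
Context (R : realType).
Implicit Types (l : R) (K : set R).

Let F l K : set R := @f0 R @` K `|` f1 l @` K.

Let F_mono l K K' : K `<=` K' -> F l K `<=` F l K'.
Proof.
by move=> KK' _ [[y Ky <-]|[y Ky <-]]; [left|right]; exists y => //; exact: KK'.
Qed.

Let cont_f0 : continuous (@f0 R).
Proof. by move=> t; apply: cvgMr_tmp; exact: cvg_id. Qed.

Let cont_f1 l : continuous (@f1 R l).
Proof.
by move=> t; apply: cvgMr_tmp; apply: cvgD; [exact: cvg_id|exact: cvg_cst].
Qed.

Let F_compact l K : compact K -> compact (F l K).
Proof.
move=> cK; apply: compactU; apply: continuous_compact => //;
  apply: continuous_subspaceT.
- exact: cont_f0.
- exact: cont_f1.
Qed.

Let I l n : set R := iter n (F l) `[0, l / 2]%classic.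

Let I_decr l : 0 < l -> forall n, I l n.+1 `<=` I l n.
Proof.
move=> l0; elim=> [|n IHn]; last exact: F_mono.
move=> _ [[y + <-]|[y + <-]]; rewrite /I /= !in_itv /= /f0 /f1 => /andP[? ?];
  apply/andP; split; lra.
Qed.

Let I_decr_le l : 0 < l -> forall m n, (m <= n)%N -> I l n `<=` I l m.
Proof.
move=> l0 m n /subnK <-; elim: (n - m)%N => [//|k IHk].
by rewrite addSn; apply: subset_trans IHk; exact: I_decr.
Qed.

Let I_compact l n : compact (I l n).
Proof.
by elim: n => [|n IHn]; [exact: segment_compact|exact: F_compact].
Qed.

Lemma self_similar_exists l : 0 < l -> exists K, self_similar l K.
Proof.
move=> l0; exists (\bigcap_n I l n); split.
- exists 0 => n _; elim: n => [|n IHn].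
    by rewrite /I /= in_itv /=; apply/andP; split; lra.
  by left; exists 0 => //; rewrite /f0 mul0r.
- apply: (subclosed_compact _ (@I_compact l 0)); last by move=> y; exact.
  by apply: closed_bigI => n _; apply: compact_closed => //; exact: norm_hausdorff.
- apply/seteqP; split=> [x Ix|_ [[y Iy <-]|[y Iy <-]] n _]; last 2 first.
  + by apply: (I_decr l0); left; exists y => //; exact: Iy.
  + by apply: (I_decr l0); right; exists y => //; exact: Iy.
  have [I0|/existsNP[m nIm]] := pselect (forall n, I l n (3 * x)).
    by left; exists (3 * x) => [n _|]; [exact: I0|rewrite /f0; lra].
  right; exists (3 * x - l) => [n _|]; last by rewrite /f1; lra.
  have [[y Iy xy]|[y Iy xy]] := Ix (maxn m n).+1 Logic.I; last first.
    have -> : 3 * x - l = y by rewrite -xy /f1; lra.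
    exact: (I_decr_le l0 (leq_maxr m n)).
  exfalso; apply: nIm.
  have -> : 3 * x = y by rewrite -xy /f0; lra.
  exact: (I_decr_le l0 (leq_maxl m n)).
Qed.

Let self_similar_sub l K K' :
  self_similar l K -> self_similar l K' -> K `<=` K'.
Proof.
move=> [_ cK KE] [[z K'z] cK' K'E] x Kx.
have [M [_ /(_ (M + 1) (ltr_pwDr ltr01 (lexx M))) HM]] := compact_bounded cK.
have Kle : exists2 D : R, 0 < D & forall y, K y -> `|y - z| <= D.
  exists (`|M| + `|z| + 1) => [|y Ky].
    have := normr_ge0 M; have := normr_ge0 z; lra.
  have := HM _ Ky => /=.
  have := ler_normB y z; have := ler_norm M; lra.
have [D D0 HD] := Kle.
have approx n : forall y, K y -> exists2 y', K' y' & `|y - y'| <= D / 3 ^+ n.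
  elim: n => [|n IHn] y Ky.
    by exists z => //; rewrite expr0 divr1; exact: HD.
  have e3 (a : R) : a / 3 <= D / 3 ^+ n.+1 <-> a <= D / 3 ^+ n.
    by rewrite exprSr invfM mulrA ler_pM2r ?invr_gt0.
  move: Ky; rewrite {1}KE => -[[t Kt <-]|[t Kt <-]];
    have [t' K't' tt'] := IHn _ Kt.
  - exists (f0 t'); first by rewrite K'E; left; exists t'.
    by rewrite /f0 -mulrBl normrM [`|3^-1|]ger0_norm ?invr_ge0//; apply/e3.
  - exists (f1 l t'); first by rewrite K'E; right; exists t'.
    rewrite /f1 -mulrBl normrM [`|3^-1|]ger0_norm ?invr_ge0//.
    by rewrite opprD addrACA subrr addr0; apply/e3.
have clK' : closed K' by apply: compact_closed => //; exact: norm_hausdorff.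
apply: clK' => B /nbhs_ballP[e /= e0 eB].
have [n Dn] : exists n, D / 3 ^+ n < e.
  have : (fun n => D * (3^-1 ^+ n)) @ \oo --> D * 0.
    by apply: cvgMl_tmp; apply: cvg_expr; rewrite ger0_norm ?invr_ge0//; lra.
  rewrite mulr0 => /cvgrPdist_lt/(_ e e0)[n _ /(_ n (leqnn n))] /=.
  rewrite sub0r normrN exprVn => h; exists n.
  exact: le_lt_trans (ler_norm _) h.
have [y' K'y' xy'] := approx n _ Kx.
by exists y'; split => //; apply: eB; exact: le_lt_trans Dn.
Qed.

Lemma E_self_similar l : 0 < l -> self_similar l (E l).
Proof. by move=> l0; apply: xgetPex; exact: self_similar_exists. Qed.

Lemma E_unique l K : 0 < l -> self_similar l K -> K = E l.
Proof.
move=> l0 sK; have sE := E_self_similar l0.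
apply/seteqP; split; first exact: self_similar_sub sK sE.
exact: self_similar_sub sE sK.
Qed.

End well_defined.

(* Main.v *)
Require Import Defs.
From HB Require Import structures.
From mathcomp Require Import all_boot all_order all_algebra.
From mathcomp Require Import all_classical all_reals all_analysis.
From mathcomp Require Import ring lra.
Set Implicit Arguments. Unset Strict Implicit. Unset Printing Implicit Defensive.
Import Order.TTheory GRing.Theory Num.Theory.
Import numFieldNormedType.Exports.
Local Open Scope classical_set_scope.
Local Open Scope ring_scope.

(* Since E l = l * E 1, a real l > 0 belongs to Lambda x iff x / l belongs to
   C = E 1, so Lambda x is the image of the positive part of C under
   y |-> x / y.  As C is covered by 2^n intervals of length comparable to 3^-n
   and the inversion is Lipschitz away from 0, Lambda x is null and has empty
   interior; it has no isolated point because C has none; and it inherits its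
   minimum from max C = 1/2 and its unboundedness from the points 1/2 / 3^n
   of C. *)

(** * Limits of geometric sequences and a Lipschitz bound for inversion *)

Section numeric.
Context (R : realType).
Implicit Types e : R.

Lemma div_exp3S (a : R) n : a / 3 ^+ n.+1 = a / 3 ^+ n / 3.
Proof. by rewrite exprSr invfM mulrA. Qed.

Lemma ltr_div_exp3 (a e : R) : 0 < e -> exists n, a / 3 ^+ n < e.
Proof.
move=> e0.
have : (fun n => a * (3^-1 ^+ n)) @ \oo --> a * 0.
  by apply: cvgMl_tmp; apply: cvg_expr; rewrite ger0_norm ?invr_ge0//; lra.
rewrite mulr0 => /cvgrPdist_lt/(_ e e0)[n _ /(_ n (leqnn n))] /=.
rewrite sub0r normrN exprVn => h; exists n.
exact: le_lt_trans (ler_norm _) h.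
Qed.

Lemma ltr_mul_exp23 (a e : R) :
  0 < e -> exists n, (2 ^ n)%:R * (a / 3 ^+ n) < e.
Proof.
move=> e0.
have : (fun n => a * ((2 / 3) ^+ n)) @ \oo --> a * 0.
  by apply: cvgMl_tmp; apply: cvg_expr; rewrite ger0_norm; lra.
rewrite mulr0 => /cvgrPdist_lt/(_ e e0)[n _ /(_ n (leqnn n))] /=.
rewrite sub0r normrN => h; exists n.
rewrite natrX mulrCA -exprVn -exprMn.
exact: le_lt_trans (ler_norm _) h.
Qed.

Lemma div_lipschitz (x c y z : R) : 0 <= x -> 0 < c -> c <= y -> c <= z ->
  `|x / y - x / z| <= x * c^-1 ^+ 2 * `|y - z|.
Proof.
move=> x0 c0 cy cz.
have y0 := lt_le_trans c0 cy; have z0 := lt_le_trans c0 cz.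
rewrite (_ : x / y - x / z = x * (y^-1 * z^-1) * (z - y)); last first.
  by field; rewrite !gt_eqF.
rewrite normrM distrC ler_wpM2r// ger0_norm; last first.
  by rewrite !mulr_ge0 ?invr_ge0// ltW.
rewrite ler_wpM2l// expr2.
by apply: ler_pM; rewrite ?invr_ge0 ?lef_pV2 ?posrE// ltW.
Qed.

End numeric.

(** * Null sets from covers by [2 ^ n] balls of radius [D / 3 ^+ n] *)

Section triadic_cover.
Context (R : realType).
Implicit Types (A : set R) (D k r : R) (f : R -> R).

Definition covered (s : seq R) r A :=
  forall y, A y -> exists2 p, p \in s & ball p r y.

Definition triadic_cover D A :=
  forall n, exists2 s : seq R, size s = (2 ^ n)%N & covered s (D / 3 ^+ n) A.

(** By induction on [s]: the first ball is split off, and what it leaves of [A] is covered by the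
    remaining centres. *)
Lemma covered_outer_measure s r A : 0 <= r -> covered s r A ->
  (((wlength idfun)^*)%mu A <= ((size s)%:R * (r *+ 2))%:E)%E.
Proof.
move=> r0; elim: s A => [|p s IHs] A cA.
  have -> : A = set0 by apply/seteqP; split=> y // /cA[].
  by rewrite outer_measure0 mul0r.
rewrite -(setUIDK A (ball p r)).
apply: le_trans (outer_measureU2 _ _ _) _.
rewrite [size _]/= -nat1r mulrDl mul1r EFinD.
apply: leeD; last first.
  apply: IHs => y [/cA[q]]; rewrite in_cons => /predU1P[-> //|qs qy _].
  by exists q.
(* [lebesgue_measure] unfolds to this outer measure, so monotonicity applies without measurability
   of [A]. *)
have /le_trans : (((wlength idfun)^*)%mu (A `&` ball p r) <=
    lebesgue_measure (ball p r))%E.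
  by apply: le_outer_measure; exact: subIsetr.
by apply; rewrite lebesgue_measure_ball.
Qed.

(** The balls of level [n] have total length [2 * D * (2 / 3) ^+ n], which tends to 0. *)
Lemma triadic_cover_negligible D A : 0 <= D -> triadic_cover D A ->
  (@lebesgue_measure R).-negligible A.
Proof.
move=> D0 cA; apply/negligible_outer_measure/eqP.
rewrite eq_le outer_measure_ge0 andbT; apply/lee_addgt0Pr => e e0.
rewrite add0e; have [n lte] := ltr_mul_exp23 (D *+ 2) e0.
have [s szs cs] := cA n.
have r0 : 0 <= D / 3 ^+ n by rewrite divr_ge0 ?exprn_ge0.
apply: le_trans (covered_outer_measure r0 cs) _.
by rewrite lee_fin szs -mulrnAl ltW.
Qed.

(** The Lipschitz bound holds only on [A], which may miss the centres; recentring each ball at a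
    point of [A] doubles its radius, hence [D *+ 2]. *)
Lemma triadic_cover_image k D f A : 0 < k ->
    (forall y z, A y -> A z -> `|f y - f z| <= k * `|y - z|) ->
  triadic_cover D A -> triadic_cover (k * (D *+ 2)) (f @` A).
Proof.
move=> k0 lipf cA n; have [s szs cs] := cA n.
set r := D / 3 ^+ n in cs.
(* The default 0 is harmless: it arises only for balls that miss [A], and these cover nothing. *)
pose c p := xget 0 (A `&` ball p r).
exists (map (f \o c) s); first by rewrite size_map.
move=> _ [y Ay <-]; have [p ps py] := cs _ Ay.
have [Ac pc] : (A `&` ball p r) (c p) by apply: (@xgetI _ _ _ y).
exists (f (c p)); first by apply/mapP; exists p.
rewrite /ball /=; apply: le_lt_trans (lipf _ _ Ac Ay) _.
rewrite -mulrA ltr_pM2l// mulrnAl -/r.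
rewrite /ball /= in py pc.
rewrite (_ : c p - y = (p - y) - (p - c p)); last by ring.
by rewrite (le_lt_trans (ler_normB _ _))// mulr2n ltrD.
Qed.

End triadic_cover.

(** * Geometry of the Cantor set [E 1] *)

Section cantor.
Context (R : realType).
Implicit Types (l x y : R).

Lemma E_step l y : 0 < l -> E l y -> exists2 t, E l t & y = f0 t \/ y = f1 l t.
Proof.
move=> /E_self_similar[_ _ KE]; rewrite {1}KE => -[[t Kt <-]|[t Kt <-]]; exists t => //.
  by left.
by right.
Qed.

Lemma E_f0 l t : 0 < l -> E l t -> E l (f0 t).
Proof. by move=> /E_self_similar[_ _ KE] Kt; rewrite KE; left; exists t. Qed.

Lemma E_f1 l t : 0 < l -> E l t -> E l (f1 l t).
Proof. by move=> /E_self_similar[_ _ KE] Kt; rewrite KE; right; exists t. Qed.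

(** The scaled set satisfies the self-similarity equation for [l], so uniqueness identifies it with
    [E l]. *)
Lemma E_scale l : 0 < l -> E l = [set l * y | y in E 1].
Proof.
move=> l0; have [[z Ez] cE EE] := E_self_similar (ltr01 : 0 < 1 :> R).
apply/esym/E_unique => //; split.
- by exists (l * z); exists z.
- apply: continuous_compact => //; apply: continuous_subspaceT.
  exact: mulrl_continuous.
- apply/seteqP; split=> [_ [y Ey <-]|].
    have [t Et [->|->]] := E_step ltr01 Ey; [left|right];
      by exists (l * t); [exists t|rewrite /f0 /f1; field].
  move=> _ [[_ [t Et <-] <-]|[_ [t Et <-] <-]].
    by exists (f0 t); [exact: E_f0|rewrite /f0; field].
  by exists (f1 1 t); [exact: E_f1|rewrite /f1; field].
Qed.

Lemma E1_itv y : E 1 y -> 0 <= y <= 1 / 2.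
Proof.
move=> Ey; have [_ cE _] := E_self_similar (ltr01 : 0 < 1 :> R).
have [M [_ /(_ (M + 1) (ltr_pwDr ltr01 (lexx M))) HM]] := compact_bounded cE.
(* Both [f0] and [f1 1] map the [d]-neighbourhood of [[0, 1/2]] into its [d / 3]-neighbourhood;
   iterating from a crude bound on [E 1] shrinks the excess to 0. *)
have approx n : forall t, E 1 t ->
    - ((`|M| + 2) / 3 ^+ n) <= t <= 1 / 2 + (`|M| + 2) / 3 ^+ n.
  elim: n => [|n IHn] t Et.
    have := HM _ Et; rewrite /= expr0 divr1 ler_norml => /andP[? ?].
    by have := ler_norm M => ?; apply/andP; split; lra.
  rewrite div_exp3S; have [u Eu [->|->]] := E_step ltr01 Et;
    have /andP[? ?] := IHn _ Eu; rewrite /f0 /f1; apply/andP; split; lra.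
apply/andP; split; rewrite leNgt; apply/negP => ylt.
  have ny : 0 < - y by lra.
  have [n] := ltr_div_exp3 (`|M| + 2) ny.
  have /andP[? ?] := approx n _ Ey; lra.
have y2 : 0 < y - 1 / 2 by lra.
have [n] := ltr_div_exp3 (`|M| + 2) y2.
have /andP[? ?] := approx n _ Ey; lra.
Qed.

(* [p] is the fixed point of the contraction [t |-> (t + 2 * p) / 3], which is
   [f0] for [p = 0] and [f1 1] for [p = 1 / 2]. *)
Lemma E1_fixpoint (p : R) :
  (forall t, E 1 t -> E 1 ((t + 2 * p) / 3)) -> E 1 p.
Proof.
move=> Ep; have [[z Ez] cE _] := E_self_similar (ltr01 : 0 < 1 :> R).
have approx n : exists2 t, E 1 t & `|p - t| <= `|p - z| / 3 ^+ n.
  elim: n => [|n [t Et pt]]; first by exists z; rewrite // expr0 divr1.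
  exists ((t + 2 * p) / 3); first exact: Ep.
  rewrite div_exp3S (_ : p - _ = (p - t) / 3); last by field.
  by rewrite normrM [`|3^-1|]ger0_norm ?invr_ge0// ler_pM2r ?invr_gt0.
apply: (compact_closed (@norm_hausdorff _ _) cE) => B /nbhs_ballP[e /= e0 eB].
have [n ne] := ltr_div_exp3 `|p - z| e0; have [t Et pt] := approx n.
by exists t; split=> //; apply: eB; exact: le_lt_trans ne.
Qed.

Lemma E1_0 : E 1 (0 : R).
Proof.
apply: E1_fixpoint => t /(E_f0 ltr01).
by rewrite /f0 mulr0 addr0.
Qed.

Lemma E1_half : E 1 (1 / 2 : R).
Proof.
apply: E1_fixpoint => t /(E_f1 ltr01).
by rewrite /f1 mul1r divff.
Qed.

Lemma E1_half_exp n : E 1 (1 / 2 / 3 ^+ n : R).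
Proof.
elim: n => [|n IHn]; first by rewrite expr0 divr1; exact: E1_half.
by rewrite div_exp3S; exact: E_f0.
Qed.

(** At scale 1, one of the points 0 and [1 / 2] differs from [y]. Applying the same injective
    contraction to a point and its neighbour divides their distance by 3. *)
Lemma E1_perfect n y : E 1 y ->
  exists2 z, E 1 z & z != y /\ `|y - z| <= 1 / 3 ^+ n.
Proof.
elim: n y => [|n IHn] y Ey.
  have /andP[y0 y1] := E1_itv Ey.
  have [->|yN0] := eqVneq y 0.
    exists (1 / 2); first exact: E1_half.
    by split; [apply/eqP; lra|rewrite expr0 ler_norml; apply/andP; split; lra].
  exists 0; first exact: E1_0.
  split; first by rewrite eq_sym.
  by rewrite expr0 ler_norml; apply/andP; split; lra.
have [t Et yt] := E_step ltr01 Ey; have [z Ez [zt dzt]] := IHn _ Et.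
case: yt => ->; [exists (f0 z); first exact: E_f0|exists (f1 1 z);
  first exact: E_f1]; (split; first by move: zt; apply: contra_neq;
  rewrite /f0 /f1; lra); move: dzt; rewrite div_exp3S /f0 /f1 !ler_norml
  => /andP[? ?]; apply/andP; split; lra.
Qed.

(** The images of the centres under [f0] and [f1 1] double their number, while the radius is divided
    by 3. *)
Lemma E1_triadic_cover : triadic_cover 1 (E (1 : R)).
Proof.
elim=> [|n [s szs cs]].
  exists [:: 0] => // y /E1_itv/andP[y0 y1]; exists 0; first by rewrite inE.
  by rewrite /ball /= expr0 ltr_norml; apply/andP; split; lra.
exists (map (@f0 R) s ++ map (f1 1) s).
  by rewrite size_cat !size_map szs addnn -mul2n expnS.
move=> y Ey; have [t Et yt] := E_step ltr01 Ey; have [p ps] := cs _ Et.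
rewrite /ball /= ltr_norml => /andP[? ?].
case: yt => ->; [exists (f0 p)|exists (f1 1 p)].
- by rewrite mem_cat map_f.
- rewrite /ball /= div_exp3S /f0 ltr_norml; apply/andP; split; lra.
- by rewrite mem_cat map_f ?orbT.
- rewrite /ball /= div_exp3S /f1 ltr_norml; apply/andP; split; lra.
Qed.

Lemma LambdaE x l : 0 < l -> Lambda x l <-> E 1 (x / l).
Proof.
move=> l0; rewrite /Lambda /= E_scale//; split=> [[_ [y Ey <-]]|Ex].
  by rewrite mulrAC divff ?mul1r ?gt_eqF.
by split => //; exists (x / l) => //; field; rewrite gt_eqF.
Qed.

End cantor.

(** * Transfer from [E 1] to [Lambda x] by inversion *)

Section lambda_set.
Context (R : realType) (x : R) (hx : 0 < x).

Lemma Lambda_div y : 0 < y -> E 1 y -> Lambda x (x / y).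
Proof.
move=> y0 Ey; apply/LambdaE; first by rewrite divr_gt0.
by rewrite (_ : x / (x / y) = y)//; field; rewrite !gt_eqF.
Qed.

Lemma Lambda_negligible : (@lebesgue_measure R).-negligible (Lambda x).
Proof.
(* Inversion is not Lipschitz near 0, so the positive part of [E 1] is cut into countably many
   pieces bounded away from 0. *)
pose A n := [set y : R | E 1 y /\ n.+1%:R^-1 <= y].
have sub : Lambda x `<=` \bigcup_n ((fun y => x / y) @` A n).
  move=> l Ll; have l0 : 0 < l by case: Ll.
  exists (Num.truncn (l / x)) => //; exists (x / l); last first.
    by field; rewrite !gt_eqF.
  split; first exact/LambdaE.
  rewrite -[leRHS]invrK lef_pV2 ?posrE ?invr_gt0 ?divr_gt0 ?ltr0n//.
  by rewrite invf_div ltW// truncnS_gt.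
apply: (@negligibleS _ _ _ (@lebesgue_measure R) _ _ sub); apply: negligible_bigcup => n.
(* The constant of [div_lipschitz] for the lower bound [c = n.+1%:R^-1]. *)
pose k := x * n.+1%:R ^+ 2.
have k0 : 0 < k by rewrite mulr_gt0// exprn_gt0.
apply: (@triadic_cover_negligible _ (k * (1 *+ 2))).
  by rewrite mulr_ge0 ?ltW.
apply: triadic_cover_image => //; last first.
  move=> m; have [s szs cs] := E1_triadic_cover R m.
  by exists s => // y [/cs].
move=> y z [_ ny] [_ nz].
have n0 : 0 < n.+1%:R^-1 :> R by rewrite invr_gt0.
by have := div_lipschitz (ltW hx) n0 ny nz; rewrite invrK.
Qed.

End lambda_set.

Lemma negligible_interior0 (R : realType) (A : set R) :
  (@lebesgue_measure R).-negligible A -> interior A = set0.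
Proof.
move=> [B [_ B0 AB]]; apply/seteqP; split=> // y /nbhs_ballP[e /= e0 yA].
have : (lebesgue_measure (ball y e) <= lebesgue_measure B)%E.
  by apply: le_outer_measure; exact: subset_trans AB.
by rewrite B0 (lebesgue_measure_ball _ (ltW e0)) lee_fin leNgt mulrn_wgt0.
Qed.

Theorem theorem1p1 (R : realType) (x : R) (hx : 0 < x) :
  [/\ (@lebesgue_measure R).-negligible (Lambda x),
      interior (Lambda x) = set0,
      isolated (Lambda x) = set0,
      Lambda x (2 * x) /\ lbound (Lambda x) (2 * x)
    & ereal_sup (EFin @` Lambda x) = +oo%E].
Proof.
split.
- exact: Lambda_negligible.
- exact/negligible_interior0/Lambda_negligible.
- apply/seteqP; split=> // l [/set_mem Ll [V Vl VL]].
  have l0 : 0 < l by case: Ll.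
  have y0 : 0 < x / l by rewrite divr_gt0.
  have Ey : E 1 (x / l) by exact/LambdaE.
  have lE : x / (x / l) = l by field; rewrite !gt_eqF.
  (* The neighbourhood [V] isolating [l] is pulled back by inversion. A second point [z] of [E 1]
     close to [x / l] then gives a point [x / z] of [Lambda x] in [V], which must be [l],
     contradicting [z != x / l]. *)
  have : \forall z \near x / l, V (x / z) /\ 0 < z.
    near=> z; split; last by near: z; exact: lt_nbhsr.
    near: z.
    have cx : {for x / l, continuous (fun z : R => x / z)}.
      by apply: cvgMl_tmp; apply: cvgV; [rewrite gt_eqF|exact: cvg_id].
    by apply: cx; rewrite lE.
  move=> /nbhs_ballP[e /= e0 yV].
  have [n ne] := ltr_div_exp3 1 e0.
  have [z Ez [zy dzy]] := E1_perfect n Ey.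
  have [Vz z0] := yV z (le_lt_trans dzy ne).
  have : (V `&` Lambda x) (x / z) by split=> //; exact: Lambda_div.
  rewrite VL /= => zl; move/eqP: zy; apply.
  by rewrite -zl; field; rewrite !gt_eqF.
- split.
    rewrite (_ : 2 * x = x / (1 / 2)); last by field.
    by apply: Lambda_div => //; exact: E1_half.
  move=> l Ll; have l0 : 0 < l by case: Ll.
  have /E1_itv/andP[_] : E 1 (x / l) by exact/LambdaE.
  rewrite ler_pdivrMr//; lra.
- apply: hasNub_ereal_sup; last first.
    by exists (x / (1 / 2)); apply: Lambda_div => //; exact: E1_half.
  move=> [M HM].
  have M0 : 0 < `|M| + 1 by have := normr_ge0 M; lra.
  (* This [n] makes [x / (1 / 2 / 3 ^+ n)] a point of [Lambda x] above [M]. *)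
  have [n ne] := ltr_div_exp3 (1 / 2) (divr_gt0 hx M0).
  have p0 : 0 < 1 / 2 / 3 ^+ n :> R by rewrite !divr_gt0 ?exprn_gt0.
  have := HM _ (Lambda_div hx p0 (E1_half_exp R n)).
  apply/negP; rewrite -ltNge.
  apply: (@lt_trans _ _ (`|M| + 1)); first by have := ler_norm M; lra.
  by rewrite ltr_pdivlMr// mulrC -ltr_pdivlMr.
Unshelve. all: by end_near. Qed.
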